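(* Let $H$ be an oriented Young subgraph of $G_{k,n}$ with outer path vertex set $V$, and let $T\in Gr^+(k,n)$ be a point for which all the minors indexed by $V$ are equal and have largest value, i.e. $\Delta_I(T)=\Delta_{I'}(T)\ge\Delta_K(T)$ for all $I,I'\in V$ and all $K\in\binom{[n]}{k}$. Then for any vertex $D$ of $H$ with $D\notin V$, $$\Delta_D(T)<\Delta_C(T)\quad\text{and}\quad \Delta_D(T)<\Delta_A(T),$$ where $C$ is the vertex of $H$ right above $D$ and $A$ is the vertex of $H$ immediately to the left of $D$.
   Context: Notation: $[n]=\{1,\dots,n\}$ and $\binom{[n]}{k}$ is the set of $k$-element subsets of $[n]$. For a real $k\times n$ matrix $A$ of rank $k$ and $I\in\binom{[n]}{k}$, $\Delta_I(A)$ is the determinant of the $k\times k$ submatrix with column set $I$ (in increasing order). The positive Grassmannian $Gr^+(k,n)$ is the set of points of the real Grassmannian $Gr(k,n)$ (matrices modulo row operations) represented by matrices with all $\Delta_I>0$; equalities and inequalities between the $\Delta_I$ are taken for such representatives (they are defined up to a common positive factor). The graph $G_{k,n}$: the directed graph with vertex set $\binom{[n]}{k}$ (equivalently, indicator vectors $\epsilon_I\in\{0,1\}^n$), with an edge (labelled $i$) from $I$ to $I'$ whenever for some $i\in[n]$ one has $i\in I$, $i+1\notin I$ and $I'=(I\setminus\{i\})\cup\{i+1\}$, indices taken modulo $n$ (so $n+1=1$). Oriented Young graph: take a (nonempty) Young diagram in English notation, rotate it by 180 degrees, and regard it as a directed graph whose vertices are the corners of its boxes and whose edges are the unit sides of its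 boxes, each horizontal edge being oriented from left to right and each vertical edge from bottom to top. The vertex in the lower right corner is the origin vertex; the lower left vertex is $v_0$ and the upper right vertex is $v_1$. There are two paths along the border from $v_0$ to $v_1$: the inner path, passing through the origin vertex, and the outer path, the other one. $V$ denotes the set of vertices of the outer path (including $v_0,v_1$). An oriented Young subgraph of $G_{k,n}$ is a (directed) subgraph of $G_{k,n}$ that is an oriented Young graph; its vertices are thus elements of $\binom{[n]}{k}$. *)

(* Defs.v *)
From mathcomp Require Import all_boot all_order all_algebra.
From mathcomp Require Import reals.

Set Implicit Arguments.
Unset Strict Implicit.
Unset Printing Implicit Defensive.

Import Order.TTheory GRing.Theory Num.Theory.
Local Open Scope ring_scope.

(* The indices 1, ..., n are represented by 0, ..., n - 1 in 'I_n. *)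
Definition ksubset (k n : nat) := {I : {set 'I_n} | #|I| == k}.

(* [enum_val] lists the elements of a set of ordinals in increasing order. *)
Definition column_of k n (I : ksubset k n) (j : 'I_k) : 'I_n :=
  enum_val (cast_ord (esym (eqP (valP I))) j).

Definition minor (R : realType) k n (M : 'M[R]_(k, n)) (I : ksubset k n) : R :=
  \det (colsub (column_of I) M).

(* Points of Gr(k, n) are the k-dimensional subspaces of R^n; a matrix of
   rank k represents the point spanned by its rows. *)
Definition represents (R : realType) k n
    (M : 'M[R]_(k, n)) (T : {vspace 'rV[R]_n}) : Prop :=
  \rank M = k /\ T = <<[seq row i M | i : 'I_k]>>%VS.

(* T lies in Gr^+(k, n) exactly when it has such a representative M. *)
Definition positive_representative (R : realType) k n
    (M : 'M[R]_(k, n)) (T : {vspace 'rV[R]_n}) : Prop :=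
  represents M T /\ forall I : ksubset k n, 0 < minor M I.

(* [ordS i] is the cyclic successor of i. *)
Definition G_edge k n : rel (ksubset k n) := fun I I' =>
  [exists i, [&& i \in val I, ordS i \notin val I
               & val I' == ordS i |: (val I :\ i)]].

Definition is_young_diagram (la : seq nat) : bool :=
  [&& la != [::], all (fun m => 0 < m)%N la & sorted geq la].

Definition boxes (la : seq nat) : seq (nat * nat) :=
  [seq (i, j) | i <- iota 0 (size la), j <- iota 0 (nth 0%N la i)].

(* After the rotation by 180 degrees, row 0 is at the bottom and column 0 is
   at the right.  The pair (a, b) lies a units above and b units to the left
   of the lower right corner, so box (i, j) has lower right corner (i, j). *)
Definition corner := (nat * nat)%type.
Definition above (u : corner) : corner := (u.1.+1, u.2).
Definition left_of (u : corner) : corner := (u.1, u.2.+1).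

Definition box_corners (b : nat * nat) : seq corner :=
  [:: b; above b; left_of b; above (left_of b)].

(* The bottom, top, right and left sides, each as (source, target). *)
Definition box_sides (b : nat * nat) : seq (corner * corner) :=
  [:: (left_of b, b); (above (left_of b), above b);
      (b, above b); (left_of b, above (left_of b))].

Definition young_vertex (la : seq nat) : pred corner :=
  fun u => has (fun b => u \in box_corners b) (boxes la).

Definition young_edge (la : seq nat) : rel corner :=
  fun u v => has (fun b => (u, v) \in box_sides b) (boxes la).

(* An edge lies on the border when it is a side of exactly one box. *)
Definition border_edge (la : seq nat) : rel corner :=
  fun u v => count (fun b => (u, v) \in box_sides b) (boxes la) == 1%N.

Definition origin_vertex : corner := (0%N, 0%N).
Definition lower_left (la : seq nat) : corner := (0%N, head 0%N la).
Definition upper_right (la : seq nat) : corner := (size la, 0%N).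

(* The path is [lower_left la :: p]. *)
Definition is_outer_path (la : seq nat) (p : seq corner) : Prop :=
  [/\ path (border_edge la) (lower_left la) p,
      last (lower_left la) p = upper_right la
    & origin_vertex \notin lower_left la :: p].

Definition outer_vertex (la : seq nat) (u : corner) : Prop :=
  exists2 p, is_outer_path la p & u \in lower_left la :: p.

(* A subgraph of G_{k,n} that is an oriented Young graph, given as an embedding
   of such a graph; the values of [embed] at points that are not vertices of
   the Young graph are irrelevant. *)
Record young_subgraph (k n : nat) := YoungSubgraph {
  young_shape : seq nat;
  young_shapeP : is_young_diagram young_shape;
  embed : corner -> ksubset k n;
  embed_inj : {in young_vertex young_shape &, injective embed};
  embed_edge : forall u v, young_edge young_shape u v -> G_edge (embed u) (embed v)
}.

(* Main.v *)
(* In a box of the Young graph with corners A -> D -> C and A -> B -> C, the two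
   paths carry the same two labels i and j in opposite order, so the corners are
   S + {i, j}, S + {i+1, j}, S + {i, j+1}, S + {i+1, j+1} for one (k-2)-set S.
   The pairs {i, j} and {i+1, j+1} cross in the cyclic order, and the three-term
   Pluecker relation gives f A * f C > f B * f D for f the minor.  Hence the
   ratio f D / f C of the ends of a vertical side increases to the left, up to
   the outer path, where it is 1; likewise the ratio f D / f A of the ends of a
   horizontal side increases upwards, up to the outer path. *)
Require Import Defs.
From mathcomp Require Import all_boot all_order all_algebra all_fingroup.
From mathcomp Require Import reals zify ring lra.

Set Implicit Arguments.
Unset Strict Implicit.
Unset Printing Implicit Defensive.

Import Order.TTheory GRing.Theory Num.Theory.

(** * Young diagrams: boxes, border edges and the outer path *)

Lemma mem_boxes la a b : ((a, b) \in boxes la) = (b < nth 0 la a).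
Proof.
apply/idP/idP => [/allpairsPdep [i [j [hi hj [-> ->]]]]|h].
  by move: hj; rewrite mem_iota.
apply/allpairsPdep; exists a, b; rewrite !mem_iota; split => //=.
by rewrite add0n; case: ltnP => // le; move: h; rewrite nth_default.
Qed.

Lemma boxes_uniq la : uniq (boxes la).
Proof.
apply: allpairs_uniq_dep => [|x _|]; rewrite ?iota_uniq //.
by move=> [i j] [i' j'] _ _ [-> ->].
Qed.

Lemma border_edge_unique la u v b0 :
  b0 \in boxes la ->
  {in boxes la, forall b, ((u, v) \in box_sides b) = (b == b0)} ->
  border_edge la u v.
Proof.
move=> hb0 h; rewrite /border_edge (@eq_in_count _ _ (pred1 b0)) //.
by rewrite count_uniq_mem ?boxes_uniq // hb0.
Qed.

Lemma mem_box_sides u v b : ((u, v) \in box_sides b) =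
  [|| (u == left_of b) && (v == b),
      (u == above (left_of b)) && (v == above b),
      (u == b) && (v == above b) |
      (u == left_of b) && (v == above (left_of b))].
Proof. by rewrite /box_sides !inE !xpair_eqE. Qed.

Lemma young_row_gt0 la a : is_young_diagram la -> a < size la -> 0 < nth 0 la a.
Proof. by case/and3P => _ /all_nthP + _; apply. Qed.

Lemma young_row_anti la a b : is_young_diagram la -> a <= b -> nth 0 la b <= nth 0 la a.
Proof.
case/and3P => _ _ srt ab; case: (ltnP b (size la)) => hb; last by rewrite nth_default.
apply: (@sorted_leq_nth _ geq _ leqnn 0 _ srt) => //; last exact: leq_ltn_trans hb.
by move=> ? ? ? h1 h2; exact: leq_trans h2 h1.
Qed.

Lemma border_edge_up la a : is_young_diagram la -> a < size la ->
  border_edge la (a, nth 0 la a) (a.+1, nth 0 la a).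
Proof.
move=> hla ha; have pos := young_row_gt0 hla ha.
apply: (@border_edge_unique _ _ _ (a, (nth 0 la a).-1)); first by rewrite mem_boxes; lia.
move=> [i j]; rewrite mem_boxes mem_box_sides /above /left_of !xpair_eqE /= => h.
have [<-|ne] := eqVneq i a; lia.
Qed.

Lemma border_edge_right la a b : nth 0 la a.+1 <= b < nth 0 la a ->
  border_edge la (a.+1, b.+1) (a.+1, b).
Proof.
move=> /andP [h1 h2].
apply: (@border_edge_unique _ _ _ (a, b)); first by rewrite mem_boxes.
move=> [i j]; rewrite mem_boxes mem_box_sides /above /left_of !xpair_eqE /= => h.
have [e|ne] := eqVneq i a.+1; first subst i; lia.
Qed.

(** An explicit form of the outer path. At height 0, [0.-1 = 0] leaves only the lower left corner;
    at height [size la] the default value 0 of [nth] lets the path run right to the upper right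
    corner. *)
Definition staircase (la : seq nat) (u : corner) : bool :=
  [&& u.1 <= size la, nth 0 la u.1 <= u.2 & u.2 <= nth 0 la u.1.-1].

Lemma staircase_neq_origin la u :
  is_young_diagram la -> staircase la u -> u != origin_vertex.
Proof.
move=> hla /and3P [_ + _]; apply: contraTneq => -> /=.
by rewrite -ltnNge young_row_gt0 // lt0n size_eq0; case/and3P: hla.
Qed.

(** The walk goes right while [b] exceeds [nth 0 la a] and goes up otherwise; each step lowers
    [size la - a + b]. Staying on the staircase is recorded because it keeps the path away from the
    origin. *)
Lemma staircase_to_end la u : is_young_diagram la -> staircase la u ->
  exists p, [/\ path (border_edge la) u p, last u p = upper_right la
              & all (staircase la) (u :: p)].
Proof.
move=> hla; case: u => a b.
have [N] := ubnP (size la - a + b); elim: N a b => // N IH a b leN st.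
have /and3P [/= h1 h2 h3] := st.
have [lt|] := ltnP (nth 0 la a) b.
  case: a => [|a] in leN st h1 h2 h3 lt *; first by move: lt h3 => /=; lia.
  case: b => // b in leN st h2 h3 lt *.
  have stb : staircase la (a.+1, b) by rewrite /staircase /=; move: h3 => /=; lia.
  have [|//|p [pp pl pa]] := IH a.+1 b; first by lia.
  exists ((a.+1, b) :: p); split => //; last by rewrite /= st.
  by rewrite /= border_edge_right //; move: h3 => /=; lia.
move=> le; have eb : b = nth 0 la a by apply/eqP; rewrite eqn_leq le.
move: h1; rewrite leq_eqVlt => /predU1P [ea|lta].
  exists [::]; rewrite /= st; split => //.
  by rewrite eb ea /upper_right nth_default.
have stb : staircase la (a.+1, b).
  by rewrite /staircase /= lta eb leqnn young_row_anti.
have [|//|p [pp pl pa]] := IH a.+1 b; first by lia.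
exists ((a.+1, b) :: p); split => //; last by rewrite /= st.
by rewrite /= {1 2}eb border_edge_up.
Qed.

(** The same walk traced backwards: the predecessor of [(a.+1, b)] lies below it if
    [b = nth 0 la a], and to its left otherwise. *)
Lemma staircase_from_start la u : is_young_diagram la -> staircase la u ->
  exists p, [/\ path (border_edge la) (lower_left la) p, last (lower_left la) p = u
              & all (staircase la) (lower_left la :: p)].
Proof.
move=> hla; case: u => a b.
have [N] := ubnP (a + (nth 0 la 0 - b)); elim: N a b => // N IH a b leN st.
have /and3P [/= h1 h2 h3] := st.
case: a => [|a] in leN st h1 h2 h3 *.
  have e : lower_left la = (0, b).
    by rewrite /lower_left -nth0; congr pair; apply/eqP; rewrite eqn_leq h2 h3.
  by exists [::]; rewrite e /= st.
have anti : nth 0 la a <= nth 0 la 0 by exact: young_row_anti.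
move: h3 => /=; rewrite leq_eqVlt => /predU1P [eb|lt].
  have stb : staircase la (a, b).
    by rewrite /staircase /= eb leqnn ltnW //= young_row_anti // leq_pred.
  have [//|//|p [pp pl pa]] := IH a b.
  exists (rcons p (a.+1, b)); rewrite last_rcons rcons_path pp pl eb border_edge_up //.
  by case/andP: pa => -> pa; rewrite all_rcons -eb st.
have stb : staircase la (a.+1, b.+1) by rewrite /staircase /= h1 lt leqW.
have [|//|p [pp pl pa]] := IH a.+1 b.+1; first by lia.
exists (rcons p (a.+1, b)); rewrite last_rcons rcons_path pp pl border_edge_right ?h2 //.
by case/andP: pa => -> pa; rewrite all_rcons st.
Qed.

Lemma staircase_outer la u : is_young_diagram la -> staircase la u -> outer_vertex la u.
Proof.
move=> hla st.
have [p [pp pl pa]] := staircase_from_start hla st.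
have [q [qp ql qa]] := staircase_to_end hla st.
exists (p ++ q); last by rewrite -cat_cons mem_cat -{1}pl mem_last.
split; rewrite ?cat_path ?last_cat ?pl ?pp //.
apply/negP => /(allP _) => /(_ (staircase la)) => hin.
have /hin : all (staircase la) (lower_left la :: p ++ q).
  by rewrite -cat_cons all_cat pa; case/andP: qa.
by move/(staircase_neq_origin hla); rewrite eqxx.
Qed.

(** A vertex that is not the lower right corner of a box has [nth 0 la a <= b]. Being a corner of
    some box, it also satisfies the other bounds of the staircase, hence is outer. So every vertex
    off the outer path is the corner D of a box. *)
Lemma young_vertex_box la u : is_young_diagram la -> young_vertex la u ->
  ~ outer_vertex la u -> u \in boxes la.
Proof.
move=> hla /hasP [[i j]]; rewrite mem_boxes => hij hu nout.
case: u => a b in hu nout *; rewrite mem_boxes ltnNge; apply/negP => le; apply: nout.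
apply: staircase_outer => //; rewrite /staircase /= le /=.
have si : i < size la by case: (ltnP i (size la)) => // ge; move: hij; rewrite nth_default.
have A x y : x <= y -> nth 0 la y <= nth 0 la x by apply: young_row_anti.
have := A i.-1 i; have := A a.-1 a; rewrite !leq_pred => /(_ isT) A1 /(_ isT) A2.
by move: hu; rewrite /box_corners /above /left_of !inE !xpair_eqE /=
  => /or4P [] /andP [/eqP ea /eqP eb]; subst a b; rewrite /= in A1 le *; lia.
Qed.

Lemma young_square la (E : rel corner) a b :
  (a, b) \in boxes la -> (forall u v, young_edge la u v -> E u v) ->
  [/\ E (a, b.+1) (a, b), E (a, b) (a.+1, b), E (a, b.+1) (a.+1, b.+1)
    & E (a.+1, b.+1) (a.+1, b)].
Proof.
move=> hb hE; split; apply: hE; apply/hasP; exists (a, b) => //;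
  by rewrite mem_box_sides /above /left_of !eqxx ?orbT.
Qed.

Lemma young_box_vertices la a b : (a, b) \in boxes la ->
  [/\ young_vertex la (a, b), young_vertex la (a.+1, b), young_vertex la (a, b.+1)
    & young_vertex la (a.+1, b.+1)].
Proof.
by move=> hb; split; apply/hasP; exists (a, b) => //;
  rewrite /box_corners /above /left_of !inE !eqxx ?orbT.
Qed.

(** * Determinants of lists of columns and the three-term Pluecker relation *)

Local Open Scope ring_scope.

(** Keeping the columns in a list turns inserting and moving columns into list operations. *)
Definition cols_mx (R : comNzRingType) k (w : seq 'cV[R]_k) : 'M[R]_k :=
  \matrix_(i, j) w`_j i 0.

Lemma det_cols_swap (R : comNzRingType) k (l r : seq 'cV[R]_k) x y :
  size (l ++ x :: y :: r) = k ->
  \det (cols_mx (l ++ x :: y :: r)) = - \det (cols_mx (l ++ y :: x :: r)).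
Proof.
rewrite size_cat /= => sz.
have h1 : (size l < k)%N by lia.
have h2 : ((size l).+1 < k)%N by lia.
pose i1 := Ordinal h1; pose i2 := Ordinal h2.
have -> : cols_mx (l ++ x :: y :: r) = xcol i1 i2 (cols_mx (l ++ y :: x :: r)).
  apply/matrixP => i j; rewrite !mxE; congr (_ i 0).
  case: tpermP => [-> | -> | ] /=.
  - by rewrite !nth_cat ltnn subnn ltnNge leqnSn subSnn.
  - by rewrite !nth_cat ltnn subnn ltnNge leqnSn subSnn.
  move=> n1 n2; rewrite !nth_cat; case: ltnP => // le.
  have: (j != size l :> nat) by apply/eqP => e; apply: n1; apply/val_inj.
  have: (j != (size l).+1 :> nat) by apply/eqP => e; apply: n2; apply/val_inj.
  move=> ne1 ne2.
  by have -> : (j - size l = (j - size l - 2).+2)%N by lia.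
have ne : i1 != i2 by rewrite -val_eqE /= ltn_eqF.
by rewrite xcolE det_mulmx det_perm odd_tperm ne expr1 mulrN1.
Qed.

Lemma det_cols_move (R : comNzRingType) k (l t r : seq 'cV[R]_k) x :
  size (l ++ x :: t ++ r) = k ->
  \det (cols_mx (l ++ x :: t ++ r)) =
  (-1) ^+ size t * \det (cols_mx (l ++ t ++ x :: r)).
Proof.
elim: t l => [|y t IH] l sz; first by rewrite mul1r.
rewrite /= det_cols_swap // -cat_rcons IH ?cat_rcons ?exprS ?mulN1r ?mulNr //.
by move: sz; rewrite !size_cat /= size_cat.
Qed.

(* In a basis extending [s] by two vectors, the determinant becomes block
   triangular, which leaves a 2 x 2 determinant of coordinates. *)
Lemma det_cols_pair (R : fieldType) k (s : seq 'cV[R]_k) a b :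
  (size s + 2)%N = k -> \det (cols_mx (s ++ [:: a; b])) != 0 ->
  exists p q : 'cV[R]_k -> R, forall x y,
    \det (cols_mx (s ++ [:: x; y])) =
    \det (cols_mx (s ++ [:: a; b])) * (p x * q y - q x * p y).
Proof.
move sz : (size s) => m e; subst k => nz.
pose S : 'M[R]_(m + 2, m) := \matrix_(i, j) s`_j i 0.
pose X (x y : 'cV[R]_(m + 2)) : 'M[R]_(m + 2, 2) := \matrix_(i, j) [:: x; y]`_j i 0.
have E x y : cols_mx (s ++ [:: x; y]) = row_mx S (X x y).
  apply/matrixP => i j; rewrite !mxE; case: splitP => j' ej; rewrite !mxE nth_cat.
    by rewrite ej; case: ltnP => //; rewrite sz leqNgt ltn_ord.
  by rewrite ej sz ltnNge leq_addr /= addKn.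
set P := cols_mx _ in nz *.
have uP : P \in unitmx by rewrite unitmxE unitfE.
have ES : invmx P *m S = col_mx 1%:M 0.
  have := mulVmx uP; rewrite {2}/P E mul_mx_row.
  rewrite scalar_mx_block block_mxEh => /eq_row_mx [-> _] //.
(* [p] and [q] are the coordinates along [a] and [b] in the basis formed by the columns of [P]. *)
pose p (v : 'cV[R]_(m + 2)) : R := (invmx P *m v) (rshift m 0) 0.
pose q (v : 'cV[R]_(m + 2)) : R := (invmx P *m v) (rshift m 1) 0.
exists p, q => x y.
have -> : cols_mx (s ++ [:: x; y]) = P *m (invmx P *m row_mx S (X x y)).
  by rewrite mulmxA mulmxV // mul1mx E.
rewrite det_mulmx; congr (_ * _).
rewrite mul_mx_row ES -[invmx P *m X x y]vsubmxK -block_mxEh det_ublock det1 mul1r.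
rewrite (expand_det_row _ 0) !big_ord_recl big_ord0 /cofactor !det_mx11 !mxE.
rewrite /p /q !mxE.
have H (u : 'I_(m + 2)) j : \sum_j0 invmx P u j0 * X x y j0 j =
   \sum_j0 invmx P u j0 * [:: x; y]`_j j0 0 by apply: eq_bigr => ? _; rewrite mxE.
have -> : lift 0 0 = 1 :> 'I_2 by exact: val_inj.
rewrite !H /= expr0 expr1; ring.
Qed.

(** Each determinant is [F a b] times a 2 x 2 minor [xy] in the coordinates [p], [q], which reduces
    the claim to [ac][bd] = [ab][cd] + [ad][bc]. *)
Lemma det_cols_plucker (R : fieldType) k (s : seq 'cV[R]_k) a b c d :
  let F x y := \det (cols_mx (s ++ [:: x; y])) in
  (size s + 2)%N = k -> F a b != 0 ->
  F a c * F b d = F a b * F c d + F a d * F b c.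
Proof.
move=> F sz nz; have [p [q E]] := det_cols_pair sz nz.
have {}E x y : F x y = F a b * (p x * q y - q x * p y) by exact: E.
rewrite !(E _ c) !(E _ d).
have ab : F a b = F a b * (p a * q b - q a * p b) by exact: E.
have {ab} : p a * q b - q a * p b = 1.
  by apply: (mulfI nz); rewrite mulr1 -ab.
move=> ab; set f := F a b.
transitivity (f * f * (p a * q c - q a * p c) * (p b * q d - q b * p d)); first by ring.
(* [F a b] has been left unexpanded; inserting [ab] = 1 makes the identity homogeneous. *)
rewrite -[X in X * (f * _)]mulr1 -{1}ab. ring.
Qed.

(** * Minors indexed by sets, and the signs of inserted columns *)

Definition set_minor (R : comNzRingType) k n (M : 'M[R]_(k, n)) (A : {set 'I_n}) : R :=
  \det (cols_mx [seq col i M | i <- enum A]).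

Lemma minorE (R : realType) k n (M : 'M[R]_(k, n)) (I : ksubset k n) :
  minor M I = set_minor M (val I).
Proof.
congr (\det _); apply/matrixP => i j; rewrite !mxE.
have szj : (j < size (enum (val I)))%N by rewrite -cardE (eqP (valP I)).
rewrite (nth_map (column_of I j)) // mxE; congr (M i _).
by rewrite [LHS](enum_val_nth (column_of I j)).
Qed.

Lemma sorted_enum_ord n (A : {set 'I_n}) : sorted (fun i j : 'I_n => i < j)%N (enum A).
Proof.
have tr : transitive (fun i j : 'I_n => i < j)%N by move=> ? ? ?; exact: ltn_trans.
apply: (sorted_filter tr).
have := iota_ltn_sorted 0 n; rewrite -val_enum_ord sorted_map.
by rewrite enumT.
Qed.

Lemma ord_seq_eq n (s t : seq 'I_n) :
  sorted (fun i j : 'I_n => i < j)%N s -> sorted (fun i j : 'I_n => i < j)%N t ->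
  s =i t -> s = t.
Proof.
apply: irr_sorted_eq; first by move=> ? ? ?; exact: ltn_trans.
by move=> ?; exact: ltnn.
Qed.

Lemma sorted_cat_enum n (A B : {set 'I_n}) :
  {in A & B, forall i j : 'I_n, (i < j)%N} ->
  sorted (fun i j : 'I_n => i < j)%N (enum A ++ enum B).
Proof.
move=> AB; have tr : transitive (fun i j : 'I_n => i < j)%N.
  by move=> ? ? ?; exact: ltn_trans.
rewrite (sorted_pairwise tr) pairwise_cat -!(sorted_pairwise tr) !sorted_enum_ord !andbT.
by apply/allrelP => i j; rewrite !mem_enum; exact: AB.
Qed.

Lemma enum_setU1 n (A : {set 'I_n}) (x : 'I_n) :
  enum (x |: A) =
  enum [set i in A | (i < x)%N] ++ x :: enum [set i in A | (x < i)%N].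
Proof.
have ex : x :: enum [set i in A | (x < i)%N] = enum (x |: [set i in A | (x < i)%N]).
  rewrite -[LHS]cat1s -enum_set1; apply: ord_seq_eq; last first.
  - by move=> i; rewrite mem_cat !mem_enum !inE.
  - exact: sorted_enum_ord.
  by apply: sorted_cat_enum => i j; rewrite !inE => /eqP -> /andP [].
rewrite ex; apply: ord_seq_eq; first exact: sorted_enum_ord.
  apply: sorted_cat_enum => i j; rewrite !inE => /andP [_ ix] /predU1P [-> //|/andP [_]].
  exact: ltn_trans ix.
move=> i; rewrite mem_cat !mem_enum !inE -val_eqE /=.
by case: ltngtP => //=; rewrite ?andbT ?andbF ?orbF.
Qed.

Lemma enum_set_split n (A : {set 'I_n}) (x : 'I_n) : x \notin A ->
  enum A = enum [set i in A | (i < x)%N] ++ enum [set i in A | (x < i)%N].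
Proof.
move=> xA; apply: ord_seq_eq; first exact: sorted_enum_ord.
  by apply: sorted_cat_enum => i j; rewrite !inE => /andP [_ ix] /andP [_]; exact: ltn_trans.
move=> i; rewrite mem_cat !mem_enum !inE -andb_orr -neq_ltn.
by have [/val_inj ->|] := eqVneq (val i) x; rewrite ?andbT // (negPf xA).
Qed.

(** The sign of moving column [x] from its sorted place to the end, past the elements of [A] above
    it. *)
Definition insert_sign (R : pzRingType) n (A : {set 'I_n}) (x : 'I_n) : R :=
  (-1) ^+ #|[set i in A | (x < i)%N]|.

Lemma det_cols_setU1 (R : comNzRingType) k n (M : 'M[R]_(k, n)) (A : {set 'I_n}) x r :
  x \notin A -> (#|A| + (size r).+1)%N = k ->
  \det (cols_mx ([seq col i M | i <- enum (x |: A)] ++ r)) =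
  insert_sign R A x * \det (cols_mx ([seq col i M | i <- enum A] ++ col x M :: r)).
Proof.
move=> xA sz; rewrite enum_setU1 (enum_set_split xA) !map_cat /= -!catA /= det_cols_move.
  by rewrite size_map -cardE.
move: sz; rewrite size_cat /= size_cat !size_map (cardE A) (enum_set_split xA) size_cat.
by rewrite !addnS addnA.
Qed.

(** The larger index [y] is moved to the end first. Since [x < y], it does not pass [x], so both
    signs depend on [S] alone. *)
Lemma set_minor_setU2 (R : comNzRingType) k n (M : 'M[R]_(k, n)) (S : {set 'I_n}) (x y : 'I_n) :
  x \notin S -> y \notin S -> (x < y)%N -> (#|S| + 2)%N = k ->
  set_minor M (y |: (x |: S)) = insert_sign R S x * insert_sign R S y *
    \det (cols_mx ([seq col i M | i <- enum S] ++ [:: col x M; col y M])).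
Proof.
move=> xS yS xy sz; rewrite /set_minor -[X in cols_mx X]cats0.
have yxS : y \notin x |: S by rewrite !inE negb_or yS andbT -val_eqE /= neq_ltn xy orbT.
rewrite det_cols_setU1 //; last by rewrite cardsU1 xS -sz /=; lia.
rewrite det_cols_setU1 // mulrA; congr (_ * _).
rewrite mulrC; congr (_ * _); rewrite /insert_sign; congr (_ ^+ #|pred_of_set _|).
apply/setP => i; rewrite !inE; case: eqVneq => //= ->.
by rewrite (negPf xS) ltnNge ltnW.
Qed.

(* Every product of two complementary pairs carries the same sign. *)
Lemma set_minor_plucker (R : fieldType) k n (M : 'M[R]_(k, n)) (S : {set 'I_n})
    (a b c d : 'I_n) :
  let F x y := set_minor M (x |: (y |: S)) in
  (#|S| + 2)%N = k -> a \notin S -> b \notin S -> c \notin S -> d \notin S ->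
  (a < b < c)%N -> (c < d)%N -> F a b != 0 ->
  F a c * F b d = F a b * F c d + F a d * F b c.
Proof.
move=> F sz aS bS cS dS /andP [ab bc] cd nz.
have {}nz : F b a != 0 by rewrite /F setUCA.
have Fc x y : F x y = F y x by rewrite /F setUCA.
have ac := ltn_trans ab bc; have bd := ltn_trans bc cd; have ad := ltn_trans ab bd.
(* The larger index goes outermost, as in [set_minor_setU2]. *)
rewrite (Fc a) (Fc b d) (Fc a b) (Fc c d) (Fc a d) (Fc b c).
move: nz; rewrite /F !set_minor_setU2 // mulf_eq0 negb_or => /andP [_ nz].
have szS : (size [seq col i M | i <- enum S] + 2)%N = k by rewrite size_map -cardE.
have := det_cols_plucker (col c M) (col d M) szS nz.
move: (insert_sign _ _ _) (insert_sign _ _ _) (insert_sign _ _ _) (insert_sign _ _ _).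
set Dac := \det _; set Dbd := \det _.
set Dab := \det _; set Dcd := \det _; set Dad := \det _; set Dbc := \det _.
move=> sa sb sc sd E.
transitivity (sa * sb * sc * sd * (Dac * Dbd)); first by ring.
rewrite E; ring.
Qed.

(** * Edges and squares of the graph *)

Lemma ordS_invariant_const (X : Type) n (f : 'I_n -> X) :
  (forall x, f (ordS x) = f x) -> forall x y, f x = f y.
Proof.
move=> fS x y; have n0 : (0 < n)%N := leq_ltn_trans (leq0n x) (ltn_ord x).
suff E z : f z = f (Ordinal n0) by rewrite !E.
case: z; elim=> [|m IH] hm; first by congr f; exact: val_inj.
have hm' := ltnW hm; rewrite -(IH hm') -(fS (Ordinal hm')); congr f; apply: val_inj => /=.
by rewrite modn_small.
Qed.

(** The last clause is the edge as an identity of indicator vectors, with e_i moved to the left so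
    as to avoid subtraction in [nat]. *)
Lemma G_edgeP k n (I I' : ksubset k n) : G_edge I I' ->
  exists i, [/\ i \in val I, ordS i \notin val I, val I' = ordS i |: (val I :\ i)
    & forall y, ((y \in val I') + (y == i) = (y \in val I) + (y == ordS i))%N].
Proof.
case/existsP => i /and3P [iI SiI /eqP e]; exists i; split=> // y.
rewrite e !inE; have [->|ne] := eqVneq y (ordS i).
  by rewrite (negPf SiI) /=; have [e'|] := eqVneq (ordS i) i; first by rewrite e' iI in SiI.
by have [->|] := eqVneq y i; rewrite ?iI /=; lia.
Qed.

(* The labels of the two paths from A to C have the same sum of vectors
   e_(i+1) - e_i, and n of these sum to 0 only cyclically, so they agree up to
   order; the order differs since B and D do. *)
Lemma square_labels k n (A B C D : ksubset k n) :
  G_edge A D -> G_edge D C -> G_edge A B -> G_edge B C -> B <> D ->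
  exists i j, [/\ i \in val A, j \in val A, i != j, ordS i \notin val A
                 & ordS j \notin val A] /\
    [/\ val D = ordS i |: (val A :\ i), val B = ordS j |: (val A :\ j)
         & val C = ordS j |: (val D :\ j)].
Proof.
move=> /G_edgeP [i [iA SiA eD hD]] /G_edgeP [j [jD SjD eC hC]].
move=> /G_edgeP [p [pA SpA eB hB]] /G_edgeP [q [qB SqB _ hC']] neBD.
have pi : p != i by apply/eqP => e; apply: neBD; apply: val_inj; rewrite /= eB eD e.
(* The multiplicity of [x] among the labels of A -> D -> C minus that among the labels of A -> B ->
   C. *)
pose f x : int := ((x == i) + (x == j))%N%:Z - ((x == p) + (x == q))%N%:Z.
have fS x : f (ordS x) = f x.
  have balance (a b c d i0 i1 j0 j1 p0 p1 q0 q1 : nat) :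
      (d + i1 = a + i0)%N -> (c + j1 = d + j0)%N ->
      (b + p1 = a + p0)%N -> (c + q1 = b + q0)%N ->
      (i1 + j1)%N%:Z - (p1 + q1)%N%:Z = (i0 + j0)%N%:Z - (p0 + q0)%N%:Z by clear; lia.
  have := balance _ _ _ _ _ _ _ _ _ _ _ _ (hD _) (hC _) (hB _) (hC' (ordS x)).
  by rewrite !(inj_eq (@ordS_inj n)).
(* Otherwise [p] differs from both [i] and [j], so [f p < 0], whereas [f i >= 0] because [p != i];
   but [f] is constant. *)
have pj : p = j.
  apply/eqP/negPn/negP => pj; have := ordS_invariant_const fS p i.
  by rewrite /f (eq_sym i p) (negPf pi) (negPf pj) !eqxx;
    case: (p == q); case: (i == j); case: (i == q).
by exists i, j; rewrite -pj in eC *; split; split => //; rewrite eq_sym.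
Qed.

(** The two products are two of the three Pluecker products; the third,
    [F i (ordS i) * F j (ordS j)], is their difference and is positive. *)
Lemma minor_square_lt (R : realType) k n (M : 'M[R]_(k, n)) (A B C D : ksubset k n) :
  (forall I : ksubset k n, 0 < minor M I) ->
  G_edge A D -> G_edge D C -> G_edge A B -> G_edge B C -> B <> D ->
  minor M D * minor M B < minor M A * minor M C.
Proof.
move=> pos AD DC AB BC neBD.
have [i [j [[iA jA ij SiA SjA] [eD eB eC]]]] := square_labels AD DC AB BC neBD.
have Sij : ordS i != ordS j by rewrite (inj_eq (@ordS_inj n)).
have ne x y : x \notin val A -> y \in val A -> x != y.
  by move=> xA yA; apply: contraNneq xA => ->.
have Sii := ne _ _ SiA iA; have Sij' := ne _ _ SiA jA.
have Sji := ne _ _ SjA iA; have Sjj := ne _ _ SjA jA.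
pose S := val A :\ i :\ j.
have cS : (#|S| + 2)%N = k.
  have := cardsD1 j (val A :\ i); rewrite !in_setD1 jA eq_sym ij -/S => ej.
  by have := cardsD1 i (val A); rewrite (eqP (valP A)) iA ej => ->; rewrite addnC addnA.
have iS : i \notin S by rewrite !inE eqxx andbF.
have jS : j \notin S by rewrite !inE eqxx.
have SiS : ordS i \notin S by rewrite !inE (negPf SiA) !andbF.
have SjS : ordS j \notin S by rewrite !inE (negPf SjA) !andbF.
pose F x y := set_minor M (x |: (y |: S)).
have FC x y : F x y = F y x by rewrite /F setUCA.
have Fpos x y : x != y -> x \notin S -> y \notin S -> 0 < F x y.
  move=> xy xS yS; have cF : #|x |: (y |: S)| == k.
    by rewrite !cardsU1 yS in_setU1 negb_or xy xS -[X in _ == X]cS addn2.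
  pose I : ksubset k n := exist (fun J : {set 'I_n} => #|J| == k) _ cF.
  by have := pos I; rewrite minorE.
have EA : minor M A = F i j.
  rewrite minorE; congr set_minor; apply/setP => x; rewrite !inE.
  have [->|_] := eqVneq x i; first by rewrite iA.
  by have [->|] := eqVneq x j; rewrite ?jA.
have ED : minor M D = F (ordS i) j.
  rewrite minorE eD; congr set_minor; apply/setP => x; rewrite !inE.
  by have [->|] := eqVneq x j; rewrite //= (eq_sym j i) ij jA orbT.
have EB : minor M B = F i (ordS j).
  rewrite minorE eB; congr set_minor; apply/setP => x; rewrite !inE.
  have [->|xi] := eqVneq x i; first by rewrite ij iA orbT.
  by [].
have EC : minor M C = F (ordS i) (ordS j).
  rewrite minorE eC eD; congr set_minor; apply/setP => x; rewrite !inE.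
  have [->|xi] := eqVneq x (ordS i); first by rewrite Sij' orbT.
  by [].
rewrite EA EB EC ED {EA EB EC ED}.
(* The relation is symmetric in the two labels, so it suffices to treat [x < y]; then [ordS x] does
   not wrap around. *)
have key x y : x \notin S -> y \notin S -> ordS x \notin S -> ordS y \notin S ->
    (x < y)%N -> ordS x != y -> ordS y != x ->
    F x y * F (ordS x) (ordS y) = F x (ordS x) * F y (ordS y) + F (ordS x) y * F x (ordS y).
  move=> xS yS SxS SyS xy Sxy Syx.
  have P a b c d : a != b -> a \notin S -> b \notin S -> c \notin S -> d \notin S ->
      (a < b < c)%N -> (c < d)%N -> F a c * F b d = F a b * F c d + F a d * F b c.
    move=> ab aS bS cS' dS h1 h2; apply: (@set_minor_plucker _ _ _ M S a b c d) => //.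
    by rewrite gt_eqF // Fpos.
  have vSx : val (ordS x) = x.+1.
    by rewrite /= modn_small // (leq_ltn_trans xy) ?ltn_ord.
  have ltSxy : (ordS x < y)%N by rewrite ltn_neqAle Sxy vSx.
  have xSx : (x < ordS x)%N by rewrite vSx.
  (* If [y] is the last index, then [ordS y] is 0 and the increasing order is [ordS y], [x],
     [ordS x], [y]. This is a cyclic shift of the usual order, so the same pairs cross. *)
  have := ltn_ord y; rewrite leq_eqVlt => /predU1P [yn|yn].
    have vSy : val (ordS y) = 0%N by rewrite /= yn modnn.
    have Syx' : (ordS y < x)%N by rewrite ltn_neqAle Syx vSy.
    have := P (ordS y) x (ordS x) y Syx SyS xS SxS yS.
    rewrite Syx' xSx ltSxy (FC (ordS y)) (FC (ordS y) y) (FC (ordS y) x).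
    by move=> /(_ isT isT) e; rewrite mulrC e addrC; congr (_ + _); rewrite mulrC.
  have ySy : (y < ordS y)%N by rewrite /= modn_small.
  have := P x (ordS x) y (ordS y) _ xS SxS yS SyS.
  rewrite neq_ltn xSx ltSxy ySy => /(_ isT isT isT) ->.
  by rewrite (mulrC (F x (ordS y))).
have {}key : F i j * F (ordS i) (ordS j) =
    F i (ordS i) * F j (ordS j) + F (ordS i) j * F i (ordS j).
  have [lt|lt|/val_inj e] := ltngtP i j; last by rewrite e eqxx in ij.
    exact: key.
  rewrite (FC i j) (FC (ordS i)) key // addrC (FC (ordS j)) (FC j (ordS i)); lra.
by rewrite key ltrDr mulr_gt0 // Fpos // eq_sym.
Qed.

(** * Comparison of minors along rows and columns *)

Lemma staircase_row_end la a : is_young_diagram la -> (a < size la)%N ->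
  staircase la (a, nth 0%N la a) /\ staircase la (a.+1, nth 0%N la a).
Proof.
move=> hla ha; split; apply/and3P; split => //=; first exact: ltnW.
  by apply: young_row_anti => //; exact: leq_pred.
by apply: young_row_anti.
Qed.

(** The box [(a, b)] is the topmost in its column, so its top side lies on the outer path. *)
Lemma staircase_column_end la a b : (nth 0%N la a.+1 <= b < nth 0%N la a)%N ->
  staircase la (a.+1, b) /\ staircase la (a.+1, b.+1).
Proof.
move=> /andP [h1 h2].
have ha : (a < size la)%N by case: (ltnP a (size la)) h2 => // le; rewrite nth_default.
by split; apply/and3P; split => //=; [exact: ltnW | exact: leqW].
Qed.

Theorem lemma5p8 (R : realType) (k n : nat) (H : young_subgraph k n)
    (T : {vspace 'rV[R]_n}) (M : 'M[R]_(k, n))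
    (hT : positive_representative M T)
    (hmax : forall (u v : corner) (K : ksubset k n),
       outer_vertex (young_shape H) u -> outer_vertex (young_shape H) v ->
       minor M (embed H u) = minor M (embed H v) /\
       minor M K <= minor M (embed H v))
    (d : corner) (hd : young_vertex (young_shape H) d)
    (hdV : ~ outer_vertex (young_shape H) d) :
  [/\ young_vertex (young_shape H) (above d), young_vertex (young_shape H) (left_of d),
      minor M (embed H d) < minor M (embed H (above d))
    & minor M (embed H d) < minor M (embed H (left_of d))].
Proof.
have [_ pos] := hT; have hla := young_shapeP H.
have {hd hdV} hd := young_vertex_box hla hd hdV.
set la := young_shape H in hmax hla hd *.
pose f a b := minor M (embed H (a, b)).
have fpos a b : 0 < f a b by exact: pos.
have feq a b a' b' : staircase la (a, b) -> staircase la (a', b') -> f a b = f a' b'.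
  move=> /(staircase_outer hla) su /(staircase_outer hla) sv.
  by have [] := hmax _ _ (embed H (a, b)) su sv.
have square a b : (a, b) \in boxes la -> f a b * f a.+1 b.+1 < f a b.+1 * f a.+1 b.
  move=> hb; have [v1 _ _ v4] := young_box_vertices hb.
  have [e1 e2 e3 e4] := young_square hb (@embed_edge _ _ H).
  (* Injectivity of the embedding gives B <> D. *)
  apply: minor_square_lt => // /(embed_inj v4 v1) [/eqP].
  by rewrite gtn_eqF.
(* Induction leftwards along row [a]. The weak inequality on the left side of the box suffices; for
   the leftmost box that side lies on the outer path and gives equality. *)
have up a b : (a, b) \in boxes la -> f a b < f a.+1 b.
  have [N] := ubnP (nth 0%N la a - b); elim: N b => // N IH b leN hb.
  have le : f a b.+1 <= f a.+1 b.+1.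
    have [h|] := boolP ((a, b.+1) \in boxes la).
      by apply: ltW; apply: IH => //; rewrite mem_boxes in h; lia.
    rewrite !mem_boxes -leqNgt in hb * => le; have e : b.+1 = nth 0%N la a by lia.
    have ha : (a < size la)%N by case: (ltnP a (size la)) hb => // ?; rewrite nth_default.
    by have [s1 s2] := staircase_row_end hla ha; rewrite e (feq _ _ _ _ s1 s2).
  (* After multiplication by [f a.+1 b.+1], the square inequality and [le] chain through
     [f a b.+1 * f a.+1 b]. *)
  rewrite -(ltr_pM2r (fpos a.+1 b.+1)) (lt_le_trans (square _ _ hb)) //.
  by rewrite mulrC ler_pM2l.
(* The same induction upwards along column [b], starting from the topmost box, whose top side lies
   on the outer path. *)
have left a b : (a, b) \in boxes la -> f a b < f a b.+1.
  have [N] := ubnP (size la - a); elim: N a => // N IH a leN hb.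
  have ha : (a < size la)%N.
    by move: hb; rewrite mem_boxes; case: (ltnP a (size la)) => // ?; rewrite nth_default.
  have le : f a.+1 b <= f a.+1 b.+1.
    have [h|] := boolP ((a.+1, b) \in boxes la).
      by apply: ltW; apply: IH => //; lia.
    rewrite !mem_boxes -leqNgt in hb * => le.
    have [|s1 s2] := @staircase_column_end la a b; first by rewrite le hb.
    by rewrite (feq _ _ _ _ s1 s2).
  by rewrite -(ltr_pM2r (fpos a.+1 b.+1)) (lt_le_trans (square _ _ hb)) // ler_pM2l.
case: d hd => a b hd; have [_ v2 v3 _] := young_box_vertices hd.
by split => //; [exact: up | exact: left].
Qed.
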